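(* Let $\epsilon>0$ be a constant. Let $k$ and $U$ be arbitrary parameters with $U\ge k^{1+\epsilon}$, let $p>U$ be a prime and $m\le U$ a positive integer, and let $h(x)=((\sigma x+\tau)\bmod p)\bmod m$ with $\sigma,\tau\in[p]$ chosen independently and uniformly at random. Then there exist a set $X\subseteq[U]$ of $k$ keys, a key $x\notin X$ and buckets $a,b\in[m]$ such that, for $y,z\in X$ chosen independently and uniformly at random, $$\Pr\big(h(y)=h(z)=b\;\big|\;h(x)=a\big)\ge\frac{1}{mk}\exp\!\left(\Omega\!\left(\sqrt{\min\left(\tfrac{\log k}{\log\log k},\tfrac{\log U}{\log^2\log U}\right)}\right)\right).$$
   Context: $[N]=\{0,1,\dots,N-1\}$. The probability is over $\sigma,\tau,y,z$. The constant in $\Omega(\cdot)$ may depend on $\epsilon$. *)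

(* Defs.v *)
From HB Require Import structures.
From mathcomp Require Import all_boot all_order all_algebra.
From mathcomp Require Import all_classical all_reals all_analysis.
Set Implicit Arguments. Unset Strict Implicit. Unset Printing Implicit Defensive.
Import Order.TTheory GRing.Theory Num.Theory.
Local Open Scope ring_scope.

Definition hsh (p m sigma tau x : nat) : nat := ((sigma * x + tau) %% p) %% m.

Definition joint_count (p m U : nat) (X : {set 'I_U}) (x a b : nat) : nat :=
  (\sum_(s < p) \sum_(t < p) \sum_(y in X) \sum_(z in X)
     [&& hsh p m s t y == b, hsh p m s t z == b & hsh p m s t x == a])%N.

Definition cond_count (p m x a : nat) : nat :=
  (\sum_(s < p) \sum_(t < p) (hsh p m s t x == a))%N.

Definition prob_joint (R : realType) (p m U : nat) (X : {set 'I_U}) (x a b : nat) : R :=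
  (joint_count p m X x a b)%:R / ((p * p * #|X| * #|X|)%N)%:R.

Definition prob_cond (R : realType) (p m x a : nat) : R :=
  (cond_count p m x a)%:R / ((p * p)%N)%:R.

Definition cond_prob (R : realType) (p m U : nat) (X : {set 'I_U}) (x a b : nat) : R :=
  prob_joint R p m X x a b / prob_cond R p m x a.

Definition rate (R : realType) (k U : nat) : R :=
  Num.min (ln (k%:R : R) / ln (ln (k%:R : R)))
          (ln (U%:R : R) / (ln (ln (U%:R : R))) ^+ 2).

(* Main.v *)
(**
Take [x = 0] and [a = b = 0], and let [J = ceil(p / m)] be the number of multiples
of [m] in [[p]].  If [y = g r] and [z = g s] with [r, s <= M], then the pairs
[sigma = m phi / g mod p], [tau = m i] with [0 <= phi M <= J/2], [0 <= i < J/2] send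
[x], [y] and [z] all to bucket [0]; there are at least [J^2 / (4 M)] of them,
so the joint probability is governed by the GCD-type sum of [1 / M] over [X * X].

To make that sum large, take [2h] primes below [Q = 4 h w <= 2^w] (Chebyshev's bound,
via the central binomial coefficient) and the products [d_S] of [h] of them.  If
[#|S :\: V| = #|V :\: S| = j] then [M <= Q^j], and every [S] has [C(h, j)^2] such
neighbours, which is at least [(4 Q)^j] as soon as [16 j^2 w <= h].  The set [X]
consists of about [k / C(2h, h)] disjoint dilates [(P i + 1) d_S], with [P] the product
of all the primes, padded arbitrarily to size [k]; this yields a conditional
probability of at least [4^j / (8 m k)].  Finally [w ~ 4 ln ln k],
[h ~ min(ln k / 2, c1 ln U / ln ln U)] and [j ~ sqrt(h / (16 w))].
*)
Require Import Defs.
From HB Require Import structures.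
From mathcomp Require Import all_boot all_order all_algebra.
From mathcomp Require Import all_classical all_reals all_analysis.
(* Reimported so that the finite-set lemmas shadow their classical_sets namesakes. *)
From mathcomp Require Import fintype finset.
From mathcomp Require Import zify ring lra.
Import Order.TTheory GRing.Theory Num.Theory.
Local Open Scope ring_scope.

Set Implicit Arguments. Unset Strict Implicit. Unset Printing Implicit Defensive.

(** * Primes from the central binomial coefficient *)

Local Open Scope nat_scope.

(** After multiplication by [j!] the factors compare one by one: n (j - i) <= (n - i) j. *)
Lemma leq_expn_bin (n j : nat) : (j <= n -> n ^ j <= 'C(n, j) * j ^ j)%N.
Proof.
move=> jn; rewrite -(leq_pmul2r (fact_gt0 j)) mulnAC bin_ffact -{1}(ffactnn j).
have constX x : (x ^ j = \prod_(i < j) x)%N by rewrite prod_nat_const card_ord.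
rewrite !ffact_prod !constX -!big_split /=.
by apply: leq_prod => i _; have := ltn_ord i; nia.
Qed.

(** By Legendre's formula the exponent is the sum over k of floor(2N / p^k) - 2 floor(N / p^k); each
    term is at most 1, and those with p^k > 2N vanish. *)
Lemma pfactor_central_bin_leq (p N : nat) :
  (prime p -> 0 < N -> p ^ logn p 'C(N.*2, N) <= N.*2)%N.
Proof.
move=> pr_p N_gt0; have p_gt1 := prime_gt1 pr_p.
have N2_gt0 : (0 < N.*2)%N by rewrite double_gt0.
set e := trunc_log p N.*2.
suff le_e : (logn p 'C(N.*2, N) <= e)%N.
  by apply: leq_trans (trunc_logP p_gt1 N2_gt0); rewrite leq_exp2l.
have lt_e k : (e < k -> N.*2 %/ p ^ k = 0)%N.
  move=> ek; apply: divn_small; apply: leq_trans (trunc_log_ltn _ p_gt1) _.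
  by rewrite leq_exp2l.
have e_le : (e <= N.*2)%N.
  apply: leq_trans (trunc_logP p_gt1 N2_gt0); exact: ltnW (ltn_expl _ p_gt1).
(* All factorials get the same range up to [e]: the terms dropped or added are zero. *)
have legendre n : (n <= N.*2 -> logn p n`! = \sum_(1 <= k < e.+1) n %/ p ^ k)%N.
  move=> n_le; rewrite logn_fact //.
  have tail a b : (e < a -> \sum_(a <= k < b) n %/ p ^ k = 0)%N.
    move=> ea; rewrite big_nat_cond big1 // => k /andP[/andP[ak _] _].
    apply/eqP; rewrite -leqn0 -(lt_e k (leq_trans ea ak)); exact: leq_div2r.
  have [ne|en] := leqP n e.
    rewrite [RHS](big_cat_nat (n := n.+1)) //= [X in (_ + X)%N](_ : _ = 0)%N ?addn0 //.
    rewrite big_nat_cond big1 // => k /andP[/andP[nk _] _].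
    by apply: divn_small; apply: ltn_trans nk (ltn_expl _ p_gt1).
  rewrite [LHS](@big_cat_nat _ _ _ e.+1) ?ltnS ?(ltnW en) //= [X in (_ + X)%N]tail //.
  exact: addn0.
have N_le : (N <= N.*2)%N by rewrite -addnn leq_addl.
have := congr1 (logn p) (bin_fact N_le).
have -> : (N.*2 - N = N)%N by rewrite -addnn addnK.
rewrite !lognM ?muln_gt0 ?fact_gt0 ?bin_gt0 // !legendre // => eqS.
have : (\sum_(1 <= k < e.+1) N.*2 %/ p ^ k <=
        \sum_(1 <= k < e.+1) (N %/ p ^ k + N %/ p ^ k + 1))%N.
  apply: leq_sum => k _; have : (0 < p ^ k)%N by rewrite expn_gt0 ltnW.
  move: (p ^ k)%N => q q_gt0; rewrite -ltnS ltn_divLR //.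
  have := ltn_pmod N q_gt0; have := divn_eq N q; nia.
rewrite !big_split /= sum_nat_const_nat subn1 muln1 -eqS /=; lia.
Qed.

(** The central coefficient of order N = 2hw is at least 2^N, while each of its prime powers is at
    most 2N <= 2^w. Hence it has at least N / w = 2h prime factors, none above 2N. *)
Lemma many_primes (w h : nat) : (0 < h -> 0 < w -> 4 * h * w <= 2 ^ w ->
  exists s : seq nat, [/\ uniq s, size s = 2 * h & forall p, p \in s ->
    prime p /\ p <= 4 * h * w])%N.
Proof.
move=> h_gt0 w_gt0 Qw; set N := (2 * h * w)%N; set c := 'C(N.*2, N).
have QE : (4 * h * w = N.*2)%N by rewrite /N; lia.
have N_gt0 : (0 < N)%N by rewrite /N; nia.
have N_le : (N <= N.*2)%N by rewrite -addnn leq_addl.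
have c_gt0 : (0 < c)%N by rewrite bin_gt0.
have le_c : (2 ^ N <= c)%N.
  rewrite -(@leq_pmul2r (N ^ N)) ?expn_gt0 ?N_gt0 // -expnMn mul2n.
  exact: leq_expn_bin.
have c_le : (c <= N.*2 ^ size (primes c))%N.
  rewrite {1}(prod_prime_decomp c_gt0) prime_decompE big_map /=.
  have -> : (N.*2 ^ size (primes c) = \prod_(p <- primes c) N.*2)%N.
    by rewrite big_const_seq count_predT iter_muln_1.
  rewrite big_seq [X in (_ <= X)%N]big_seq; apply: leq_prod => p.
  rewrite mem_primes => /and3P[pr_p _ _]; exact: pfactor_central_bin_leq.
have size_ge : (2 * h <= size (primes c))%N.
  have : (2 ^ N <= 2 ^ (w * size (primes c)))%N.
    apply: (leq_trans le_c (leq_trans c_le _)); rewrite expnM leq_exp2r //; last first.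
      rewrite lt0n; apply/eqP => s0; move: c_le; rewrite s0 expn0 => c_le.
      by have := leq_trans le_c c_le; rewrite leqNgt -{1}(expn0 2) ltn_exp2l // N_gt0.
    by rewrite -QE.
  by rewrite leq_exp2l // /N; nia.
exists (take (2 * h) (primes c)); split.
- exact: take_uniq (primes_uniq c).
- by rewrite size_takel.
move=> p /mem_take; rewrite mem_primes => /and3P[pr_p _ p_dvd]; split=> //.
rewrite QE leqNgt; apply/negP => lt_p.
have : (p %| N.*2 `!)%N by rewrite -(bin_fact N_le) dvdn_mulr.
rewrite fact_prod Euclid_dvd_prod // big_has => /hasP[i].
rewrite mem_index_iota => /andP[i_gt0 i_lt] /(dvdn_leq i_gt0); lia.
Qed.

(** * Products of distinct primes and swaps of subsets *)

Lemma dvd_prod_primes (n : nat) (q : 'I_n -> nat) (S : {set 'I_n}) (i : 'I_n) :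
  injective q -> (forall l, prime (q l)) ->
  (q i %| \prod_(l in S) q l)%N = (i \in S).
Proof.
move=> q_inj q_pr; rewrite Euclid_dvd_prod // big_has_cond.
apply/hasP/idP => [[l _ /andP[lS]]|iS]; last by exists i; rewrite ?mem_index_enum //= iS dvdnn.
by rewrite dvdn_prime2 // => /eqP/q_inj ->.
Qed.

(** Remove [A] from [S] and add [B] from its complement, both of size [j]; the pair is recovered
    from the result [V] as [S :\: V] and [V :\: S], so different pairs give different sets. *)
Lemma card_swap_neighbours (T : finType) (S : {set T}) (h j : nat) :
  #|S| = h -> #|T| = h.*2 ->
  ('C(h, j) ^ 2 <= #|[set V : {set T} | (#|S :\: V| == j) && (#|V :\: S| == j)]|)%N.
Proof.
move=> Sh Th; have CSh : #|~: S| = h by have := cardsC S; rewrite Sh Th; lia.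
pose draws (B : {set T}) := [set A : {set T} | A \subset B & #|A| == j].
pose swap (u : {set T} * {set T}) := (S :\: u.1) :|: u.2.
have swapP u : u \in setX (draws S) (draws (~: S)) ->
    S :\: swap u = u.1 /\ swap u :\: S = u.2.
  case: u => A B; rewrite !inE /= => /andP[/andP[AS _] /andP[BS _]].
  have BN x : x \in B -> x \notin S by move/(subsetP BS); rewrite inE.
  have AN x : x \in A -> x \in S by move/(subsetP AS).
  by split; apply/setP => x; rewrite !inE /=; move: (AN x) (BN x);
    case: (x \in A); case: (x \in B); case: (x \in S) => //= a b;
    do ?[by have := a isT | by have := b isT].
have swap_inj : {in setX (draws S) (draws (~: S)) &, injective swap}.
  move=> [A B] [A' B'] /swapP /= [e1 e2] /swapP /= [e3 e4] e.
  by congr pair; [rewrite -e1 -[RHS]e3 e | rewrite -e2 -[RHS]e4 e].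
rewrite expnS expn1 -{1}Sh -{1}CSh -!cards_draws -cardsX -(card_in_imset swap_inj).
apply/subset_leq_card/subsetP => _ /imsetP[u uD ->].
have [e1 e2] := swapP _ uD; move: uD; rewrite !inE e1 e2.
by case/andP => /andP[_ ->] /andP[_ ->].
Qed.

(** * Hash functions sending keys with a common factor to bucket 0 *)

(** With sigma = m a / g and tau = m b, a key g c is sent to m (a c + b) mod [p]; this number is
    already below [p], so no wrap-around spoils its divisibility by [m]. *)
Lemma pair_count_lower (p m g r s M : nat) :
  prime p -> (0 < m < p)%N -> (0 < g < p)%N -> (0 < M)%N -> (r <= M)%N -> (s <= M)%N ->
  ((p.-1 %/ m).+1 ^ 2 <= 4 * M * \sum_(u < p) \sum_(t < p)
     [&& hsh p m u t (g * r) == 0, hsh p m u t (g * s) == 0 & hsh p m u t 0 == 0])%N.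
Proof.
move=> pr_p /andP[m_gt0 m_lt] /andP[g_gt0 g_lt] M_gt0 rM sM.
have p_gt0 := prime_gt0 pr_p.
set J := (p.-1 %/ m).+1; set F := (J./2 %/ M)%N.
have mJ : (m * J.-1 < p)%N by have := leq_trunc_div p.-1 m; rewrite /J /=; lia.
have FM : (F * M <= J./2)%N := leq_trunc_div _ _.
have FJ : (F <= J.-1)%N by rewrite /F; have := leq_div J./2 M; lia.
have [g' gg'] : exists g', g * g' = 1 %[mod p].
  case: (egcdnP p g_gt0) => g' l e _; exists g'; rewrite mulnC e.
  have /eqP -> : coprime g p.
    by rewrite coprime_sym prime_coprime //; apply/negP => /(dvdn_leq g_gt0); lia.
  by rewrite modnMDl.
(* The halves add up: [a * c <= J./2] and [b <= uphalf J - 1] give [a * c + b <= J - 1]. *)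
have fit (a b c : nat) : (a <= F -> b < uphalf J -> c <= M -> m * (a * c + b) < p)%N.
  move=> aF bJ cM; have : (a * c <= F * M)%N by apply: leq_mul.
  by move=> ac; apply: leq_ltn_trans mJ; rewrite leq_mul2l; lia.
pose f (v : 'I_F.+1 * 'I_(uphalf J)) : 'I_p * 'I_p :=
  (Ordinal (ltn_pmod (m * v.1 * g') p_gt0), Ordinal (ltn_pmod (m * v.2) p_gt0)).
pose good (u : 'I_p * 'I_p) :=
  [&& hsh p m u.1 u.2 (g * r) == 0, hsh p m u.1 u.2 (g * s) == 0 & hsh p m u.1 u.2 0 == 0].
have hf v c : (c <= M)%N -> hsh p m (f v).1 (f v).2 (g * c) = 0.
  case: v => a b /= cM; rewrite /hsh /= modnDmr -modnDml modnMml modnDml.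
  have -> : (m * a * g' * (g * c) = g * g' * (m * a * c))%N by lia.
  rewrite -modnDml -modnMml gg' modnMml mul1n modnDml.
  have -> : (m * a * c + m * b = m * (a * c + b))%N by lia.
  by rewrite (modn_small (fit a b c (ltn_ord a) (ltn_ord b) cM)) modnMr.
(* Multiplying sigma by [g] gives back [m * a], which is below [p]. *)
have f_inj : injective f.
  move=> [a b] [a' b'] [] /(congr1 (fun z => z * g %% p)) /=; rewrite !modnMml.
  have cancelg x : (m * x * g' * g %% p = m * x %% p)%N.
    by rewrite -mulnA [(g' * g)%N]mulnC -modnMmr gg' modnMmr muln1.
  have bnd (x : 'I_F.+1) : (m * x < p)%N.
    by apply: leq_ltn_trans mJ; rewrite leq_mul2l (leq_trans _ FJ) ?orbT // -ltnS.
  have bnd' (x : 'I_(uphalf J)) : (m * x < p)%N by have := fit 0 x 0; rewrite mul0n; apply.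
  rewrite !cancelg !modn_small // => /eqP; rewrite eqn_pmul2l // => /eqP/val_inj ->.
  by move=> /eqP; rewrite eqn_pmul2l // => /eqP/val_inj ->.
have -> : (\sum_(u < p) \sum_(t < p) [&& hsh p m u t (g * r) == 0,
    hsh p m u t (g * s) == 0 & hsh p m u t 0 == 0] = #|[set u | good u]|)%N.
  by rewrite pair_bigA /= -sum1dep_card [RHS]big_mkcond.
have le_card : (F.+1 * uphalf J <= #|[set u | good u]|)%N.
  rewrite -{1}[F.+1]card_ord -[uphalf J]card_ord -card_prod -(card_imset _ f_inj).
  apply/subset_leq_card/subsetP => _ /imsetP[v _ ->]; rewrite inE /good !hf //=.
  by have := hf v 0 (leq0n _); rewrite muln0 => ->.
(* Rounding down in [F] is made up for by the extra value [a = F]. *)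
have FM2 : (J./2 < F.+1 * M)%N by rewrite mulSnr; have := divn_eq J./2 M;
  have := ltn_pmod J./2 M_gt0; rewrite -/F; lia.
have := uphalf_half J; have := odd_double_half J.
move: (J./2) (uphalf J) FM2 le_card => H H2 FM2 le_card e1 e2.
have : (H.+1 * H2 <= M * #|[set u | good u]|)%N.
  apply: leq_trans (_ : (F.+1 * M * H2 <= _)%N); first by rewrite leq_mul2r FM2 orbT.
  by rewrite [(F.+1 * M)%N]mulnC -mulnA leq_mul2l le_card orbT.
move=> le2; have JJ : (J * J <= 2 * H.+1 * (2 * H2))%N.
  by apply: leq_mul; clear -e1 e2; case: (odd J) e1 e2; lia.
apply: (leq_trans JJ); rewrite mulnACA -[leqRHS]mulnA; exact: leq_mul.
Qed.

(** * The key set with a large GCD sum *)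

Lemma leq_sum_subset (T : finType) (A B : {set T}) (F : T -> nat) :
  A \subset B -> (\sum_(x in A) F x <= \sum_(x in B) F x)%N.
Proof. by move=> /setIidPr AB; rewrite [leqRHS](big_setID A) /= AB leq_addr. Qed.

Lemma exists_superset_card (T : finType) (A B : {set T}) (k : nat) :
  A \subset B -> (#|A| <= k <= #|B|)%N ->
  exists X : {set T}, [/\ A \subset X, X \subset B & #|X| = k].
Proof.
move=> AB /andP[Ak kB].
have : (0 < #|[set Y : {set T} | Y \subset B :\: A & #|Y| == (k - #|A|)%N]|)%N.
  by rewrite cards_draws bin_gt0 cardsDS // leq_sub2r.
case/card_gt0P => Y; rewrite inE => /andP[YBA /eqP Yk].
exists (A :|: Y); split; first exact: subsetUl.
  by rewrite subUset AB (subset_trans YBA) // subsetDl.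
rewrite cardsU Yk (_ : A :&: Y = set0) ?cards0 ?subn0 ?subnKC //.
apply/eqP; rewrite setIC setI_eq0; apply: disjointWl YBA _.
by rewrite -setI_eq0 setDE -setIA [~: A :&: A]setIC setICr setI0.
Qed.

(** The hash function enters only through [pc], so the choice of keys is purely combinatorial. At
    least k / 2 keys come from the dilates; each has at least (4Q)^j partners contributing at least
    A / Q^j, where Q = 4hw. The factor 2 is the loss in rounding [k] down to a multiple of the
    central binomial coefficient. *)
Lemma exists_gcd_set (k U h j w : nat) :
  (0 < h -> 0 < w -> 4 * h * w <= 2 ^ w -> 16 * j ^ 2 * w <= h ->
   'C(h.*2, h) <= k -> (4 * h * w) ^ (3 * h) * k < U ->
  exists X : {set 'I_U}, [/\ #|X| = k, forall y, y \in X -> 0 < y &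
    forall (A : nat) (pc : nat -> nat -> nat),
    (forall g r s, 0 < g < U -> r <= (4 * h * w) ^ j -> s <= (4 * h * w) ^ j ->
       A <= (4 * h * w) ^ j * pc (g * r) (g * s)) ->
    4 ^ j * k * A <= 2 * \sum_(y in X) \sum_(z in X) pc y z])%N.
Proof.
move=> h_gt0 w_gt0 Qw jw k0k QU.
have [s [s_uniq s_size s_pr]] := many_primes h_gt0 w_gt0 Qw.
set Q := (4 * h * w)%N in Qw QU s_pr *; set k0 := 'C(h.*2, h) in k0k *.
have Q_gt0 : (0 < Q)%N by rewrite /Q; nia.
have jh : (j <= h)%N by nia.
pose q (i : 'I_h.*2) := nth 0 s i.
have ltis (i : 'I_h.*2) : (i < size s)%N by rewrite s_size mul2n.
have q_inj : injective q.
  by move=> i i' /eqP; rewrite nth_uniq // => /eqP/val_inj.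
have q_pr i : prime (q i) by have [] := s_pr (q i) (mem_nth _ (ltis i)).
have q_le i : (q i <= Q)%N by have [] := s_pr (q i) (mem_nth _ (ltis i)).
pose d (S : {set 'I_h.*2}) := (\prod_(i in S) q i)%N.
have d_gt0 S : (0 < d S)%N by rewrite prodn_cond_gt0 // => i _; exact: prime_gt0.
have d_le S : (d S <= Q ^ #|S|)%N.
  by rewrite -prod_nat_const; apply: leq_prod => i _.
have dvd_d S i : (q i %| d S)%N = (i \in S) by exact: dvd_prod_primes.
have d_setID S V : (d S = d (S :&: V) * d (S :\: V))%N by rewrite /d (big_setID V).
pose P := d setT; set B := (k %/ k0)%N.
have k0_gt0 : (0 < k0)%N by rewrite bin_gt0 -addnn leq_addl.
have B_gt0 : (0 < B)%N by rewrite divn_gt0.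
have Bk0 : (B * k0 <= k)%N by exact: leq_trunc_div.
have kBk0 : (k <= 2 * (B * k0))%N.
  by have := divn_eq k k0; have := ltn_pmod k k0_gt0; rewrite -/B; nia.
have P_le : (P <= Q ^ h.*2)%N by have := d_le setT; rewrite cardsT card_ord.
have P_gt0 : (0 < P)%N by exact: d_gt0.
have k_gt0 : (0 < k)%N by exact: leq_trans k0k.
case: U QU => // U QU.
pose Dm : {set 'I_B * {set 'I_h.*2}} :=
  setX setT [set S : {set 'I_h.*2} | S \subset setT & #|S| == h].
pose f (u : 'I_B * {set 'I_h.*2}) := ((P * u.1).+1 * d u.2)%N.
have DmP u : (u \in Dm) = (#|u.2| == h) by rewrite !inE subsetT.
have t_le (i : 'I_B) : ((P * i).+1 <= P * B)%N by have := ltn_ord i; nia.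
(* The multiplier is at most P B <= Q^(2h) k and [e] at most Q^h, whence the exponent 3h in the
   bound on [U]. *)
have bound (u : 'I_B * {set 'I_h.*2}) (e : nat) :
    (e <= Q ^ h -> (P * u.1).+1 * e < U.+1)%N.
  move=> e_le; apply: leq_ltn_trans QU.
  have -> : (Q ^ (3 * h) * k = Q ^ h.*2 * k * Q ^ h)%N.
    by rewrite mulnAC -expnD -addnn; congr (_ ^ _ * _); lia.
  apply: leq_mul => //; apply: leq_trans (t_le u.1) _; apply: leq_mul => //.
  by apply: leq_trans Bk0; rewrite leq_pmulr.
have f_lt u : u \in Dm -> (f u < U.+1)%N.
  by rewrite DmP => /eqP uh; apply: bound; have := d_le u.2; rewrite uh.
have f_gt0 u : (0 < f u)%N by rewrite muln_gt0 d_gt0.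
(* Every chosen prime divides [P], so the multiplier P i + 1 is prime to all of them and the set can
   be read off from [f u]. *)
have dvd_f u i : (q i %| f u)%N = (i \in u.2).
  rewrite Euclid_dvdM // dvd_d; apply: orb_idl => q_dvd; exfalso.
  have qP : (q i %| P * u.1)%N by rewrite dvdn_mulr // dvd_d inE.
  by move: q_dvd; rewrite -addn1 dvdn_addr // Euclid_dvd1.
have f_inj : injective f.
  move=> [i S] [i' S'] e; have eS : S = S'.
    by apply/setP => l; rewrite -(dvd_f (i, S)) e dvd_f.
  move: e; rewrite -eS => /eqP; rewrite /f /= eqn_pmul2r // eqSS eqn_pmul2l //.
  by move=> /eqP/val_inj ->.
pose F (u : 'I_B * {set 'I_h.*2}) : 'I_U.+1 := inord (f u).
have FE u : u \in Dm -> F u = f u :> nat by move=> uD; rewrite inordK // f_lt.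
have F_inj : {in Dm &, injective F}.
  by move=> u v uD vD /(congr1 val) /=; rewrite !FE // => /f_inj.
have card_F : #|F @: Dm| = (B * k0)%N.
  by rewrite card_in_imset // cardsX cardsT cards_draws cardsT !card_ord.
have QUk : (k <= U)%N.
  by rewrite -ltnS; apply: leq_ltn_trans QU; rewrite leq_pmull // expn_gt0 Q_gt0.
(* The key 0 is kept out of [X], to serve as [x]. *)
have FD0 : F @: Dm \subset ~: [set ord0].
  apply/subsetP => _ /imsetP[u uD ->]; rewrite !inE -val_eqE /= FE //.
  by rewrite -lt0n.
have [|X [DX X0 Xk]] := exists_superset_card (k := k) FD0.
  by rewrite card_F Bk0 cardsC1 card_ord.
exists X; split=> // [y /(subsetP X0)|A pc hpc]; first by rewrite !inE -val_eqE /= lt0n.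
(* The binomial coefficient is at least (h / j)^j, and 4 Q j^2 = 16 h w j^2 <= h^2. *)
have binQ : (4 ^ j * Q ^ j <= 'C(h, j) ^ 2)%N.
  have [->|j_gt0] := posnP j; first by rewrite bin0.
  have jj_gt0 : (0 < (j ^ j) ^ 2)%N by rewrite !expn_gt0 j_gt0.
  rewrite -(leq_pmul2r jj_gt0) -[leqRHS]expnMn.
  apply: leq_trans (_ : (h ^ j) ^ 2 <= _)%N; last by rewrite leq_exp2r // leq_expn_bin.
  rewrite -!expnM ![(j * 2)%N]mulnC !expnM -!expnMn leq_exp2r //.
  by rewrite /Q; nia.
have row u : u \in Dm ->
    ('C(h, j) ^ 2 * A <= Q ^ j * \sum_(v in Dm) pc (f u) (f v))%N.
  case: u => i S; rewrite DmP /= => /eqP Sh.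
  pose nb := [set V : {set 'I_h.*2} | (#|S :\: V| == j) && (#|V :\: S| == j)].
  have pair_inj : {in nb &, injective (pair i)} by move=> V V' _ _ [].
  have nbDm : pair i @: nb \subset Dm.
    apply/subsetP => _ /imsetP[V VS ->]; rewrite DmP /=; move: VS; rewrite inE.
    move=> /andP[/eqP SV /eqP VS]; have := cardsID V S; have := cardsID S V.
    by rewrite SV VS Sh setIC => <- ->.
  (* Only partners in the same dilate [i] are counted. *)
  apply: leq_trans (_ : Q ^ j * \sum_(v in pair i @: nb) pc (f (i, S)) (f v) <= _)%N.
    rewrite big_imset // big_distrr /=; apply: leq_trans (_ : \sum_(V in nb) A <= _)%N.
      by rewrite sum_nat_const leq_mul2r card_swap_neighbours ?orbT // card_ord.
    apply: leq_sum => V; rewrite inE => /andP[/eqP SV /eqP VS].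
    (* The common factor is (P i + 1) [d (S :&: V)]; each cofactor is a product of [j] primes, so at
       most [Q ^ j]. *)
    rewrite /f /= (d_setID S V) (d_setID V S) [V :&: S]setIC !mulnA.
    have SIV : (#|S :&: V| <= h)%N by rewrite -[leqRHS]Sh subset_leq_card ?subsetIl.
    apply: hpc; [|by have := d_le (S :\: V); rewrite SV|by have := d_le (V :\: S); rewrite VS].
    rewrite muln_gt0 d_gt0 (bound (i, S)) // (leq_trans (d_le _)) //.
    exact: leq_pexp2l.
  by rewrite leq_mul2l leq_sum_subset ?orbT.
have D_sum : (B * k0 * ('C(h, j) ^ 2 * A) <=
    Q ^ j * \sum_(y in X) \sum_(z in X) pc y z)%N.
  (* Pairs involving a padding key are dropped. *)
  apply: leq_trans (_ : Q ^ j * \sum_(y in F @: Dm) \sum_(z in F @: Dm) pc y z <= _)%N.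
    rewrite big_imset // big_distrr /= -card_F card_in_imset // -sum_nat_const.
    apply: leq_sum => u uD; rewrite big_imset //= FE //.
    under eq_bigr => v vD do rewrite FE //.
    exact: row.
  rewrite leq_mul2l; apply/orP; right.
  apply: leq_trans (leq_sum_subset _ DX); apply: leq_sum => y _.
  exact: leq_sum_subset.
have Qj_gt0 : (0 < Q ^ j)%N by rewrite expn_gt0 Q_gt0.
rewrite -(leq_pmul2l Qj_gt0) [leqRHS]mulnCA.
apply: leq_trans (_ : 2 * (B * k0 * ('C(h, j) ^ 2 * A)) <= _)%N; last by rewrite leq_mul2l.
move: ('C(h, j) ^ 2)%N (4 ^ j)%N (Q ^ j)%N binQ => c a b abc.
have -> : (b * (a * k * A) = k * (a * b) * A)%N by lia.
have -> : (2 * (B * k0 * (c * A)) = 2 * (B * k0) * c * A)%N by lia.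
by apply: leq_mul => //; apply: leq_mul.
Qed.

(** * From pair counts to the conditional probability *)

Local Open Scope ring_scope.

(** For [x = 0] the hash value is tau mod [m] whatever sigma is, and [t %/ m] tells the multiples of
    [m] below [p] apart. This count is a denominator, hence an upper bound and positivity. *)
Lemma cond_count_bounds (p m : nat) : (0 < p -> 0 < m ->
  0 < cond_count p m 0 0 <= p * (p.-1 %/ m).+1)%N.
Proof.
move=> p_gt0 m_gt0; rewrite /cond_count /hsh.
under eq_bigr => s _ do under eq_bigr => t _ do
  rewrite muln0 add0n (modn_small (ltn_ord t)).
rewrite sum_nat_const card_ord muln_gt0 p_gt0 leq_pmul2l //=.
have -> : (\sum_(t < p) (t %% m == 0) = #|[set t : 'I_p | t %% m == 0]|)%N.
  by rewrite -sum1dep_card [RHS]big_mkcond.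
apply/andP; split; first by apply/card_gt0P; exists (Ordinal p_gt0); rewrite inE mod0n.
have lt_t (t : 'I_p) : (t %/ m < (p.-1 %/ m).+1)%N.
  by rewrite ltnS leq_div2r //; have := ltn_ord t; lia.
rewrite -[leqRHS]card_ord.
apply: (@leq_card_in _ _ (fun t : 'I_p => Ordinal (lt_t t))) => s t.
rewrite !inE => /eqP s0 /eqP t0 [] e; apply: val_inj.
by rewrite /= (divn_eq s m) (divn_eq t m) s0 t0 e.
Qed.

Lemma joint_countE (p m U : nat) (X : {set 'I_U}) (x a b : nat) :
  joint_count p m X x a b = (\sum_(y in X) \sum_(z in X) \sum_(s < p) \sum_(t < p)
     [&& hsh p m s t y == b, hsh p m s t z == b & hsh p m s t x == a])%N.
Proof.
rewrite /joint_count; etransitivity.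
  by apply: eq_bigr => s _; exact: exchange_big.
rewrite exchange_big /=; apply: eq_bigr => y _; etransitivity.
  by apply: eq_bigr => s _; exact: exchange_big.
exact: exchange_big.
Qed.

(** The quotient is joint / (k^2 cond), and cond <= p J <= m J^2 with J = ceil(p / m); the powers of
    J cancel. *)
Lemma cond_prob_lower (R : realType) (p m U N : nat) (X : {set 'I_U}) :
  (0 < m < p)%N -> (0 < #|X|)%N ->
  (N * #|X| * (p.-1 %/ m).+1 ^ 2 <= 8 * joint_count p m X 0 0 0)%N ->
  (N%:R : R) / (8 * (m%:R * #|X|%:R)) <= cond_prob R p m X 0 0 0.
Proof.
move=> /andP[m_gt0 mp] X_gt0 joint_ge.
have p_gt0 : (0 < p)%N by apply: leq_ltn_trans mp.
have /andP[c_gt0 c_le] := cond_count_bounds p_gt0 m_gt0.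
have pmJ : (p <= m * (p.-1 %/ m).+1)%N.
  by have := divn_eq p.-1 m; have := ltn_pmod p.-1 m_gt0; lia.
rewrite /cond_prob /prob_joint /prob_cond.
set J := (p.-1 %/ m).+1 in joint_ge c_le pmJ *.
move: (joint_count _ _ _ _ _ _) (cond_count _ _ _ _) #|X| X_gt0 joint_ge c_gt0 c_le
  => jc cc k k_gt0 joint_ge c_gt0 c_le.
have -> : jc%:R / (p * p * k * k)%:R / (cc%:R / (p * p)%:R) =
    jc%:R / (k%:R ^+ 2 * cc%:R) :> R.
  rewrite !natrM; field; rewrite !pnatr_eq0; lia.
rewrite ler_pdivlMr ?mulr_gt0 ?exprn_gt0 ?ltr0n //.
rewrite mulrAC ler_pdivrMr ?mulr_gt0 ?ltr0n //.
rewrite -(natrX R) -!natrM ler_nat.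
have : (cc <= m * J ^ 2)%N.
  apply: leq_trans c_le _; rewrite expnS expn1 mulnA leq_mul2r pmJ orbT //.
move=> cc_le; apply: (@leq_trans (N * (k ^ 2 * (m * J ^ 2)))%N).
  by rewrite !leq_mul2l cc_le !orbT.
have -> : (N * (k ^ 2 * (m * J ^ 2)) = N * k * J ^ 2 * (m * k))%N by lia.
have -> : (jc * (8 * (m * k)) = 8 * jc * (m * k))%N by lia.
by rewrite leq_mul2r joint_ge orbT.
Qed.

Lemma exists_correlated_set (R : realType) (k U p m h j w : nat) :
  prime p -> (U < p)%N -> (0 < m)%N -> (m <= U)%N -> (0 < k)%N ->
  (0 < h)%N -> (0 < w)%N -> (4 * h * w <= 2 ^ w)%N -> (16 * j ^ 2 * w <= h)%N ->
  ('C(h.*2, h) <= k)%N -> ((4 * h * w) ^ (3 * h) * k < U)%N ->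
  exists (X : {set 'I_U}) (x : 'I_U) (a b : 'I_m),
    [/\ #|X| = k, x \notin X &
      (4 ^ j)%N%:R / (8 * (m%:R * k%:R)) <= cond_prob R p m X x a b].
Proof.
move=> pr_p Up m_gt0 mU k_gt0 h_gt0 w_gt0 Qw jw hk QU.
have mp : (0 < m < p)%N by rewrite m_gt0 (leq_ltn_trans mU).
have U_gt0 : (0 < U)%N := leq_trans m_gt0 mU.
have [X [Xk X_gt0 HX]] := exists_gcd_set h_gt0 w_gt0 Qw jw hk QU.
exists X, (Ordinal U_gt0), (Ordinal m_gt0), (Ordinal m_gt0); split=> //.
  by apply/negP => /X_gt0.
rewrite -Xk; apply: cond_prob_lower => //=; rewrite ?Xk // joint_countE.
(* The factor 4 of [pair_count_lower] is put into [pc]; with the 2 of [exists_gcd_set] it makes the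
   8. *)
pose pc y z := (4 * \sum_(s < p) \sum_(t < p)
  [&& hsh p m s t y == 0, hsh p m s t z == 0 & hsh p m s t 0 == 0])%N.
have := HX ((p.-1 %/ m).+1 ^ 2)%N pc.
rewrite /pc; under eq_bigr => y _ do rewrite -big_distrr /=.
rewrite -big_distrr [(2 * (4 * _))%N]mulnA /=; apply=> g r s /andP[g_gt0 gU] rQ sQ.
rewrite mulnCA mulnA; apply: pair_count_lower => //; last first.
  by rewrite expn_gt0 !muln_gt0 h_gt0 w_gt0.
by rewrite g_gt0 (ltn_trans gU).
Qed.

(** * Exponential estimates and the choice of parameters *)

Lemma central_bin_leq (h : nat) : ('C(h.*2, h) <= 4 ^ h)%N.
Proof.
have := cards_draws [set: 'I_h.*2] h; rewrite cardsT card_ord => <-.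
rewrite (_ : 4 = 2 ^ 2)%N // -expnM mul2n.
have <- : #|powerset [set: 'I_h.*2]| = (2 ^ h.*2)%N by rewrite card_powerset cardsT card_ord.
by apply/subset_leq_card/fintype.subsetP => A; rewrite !inE finset.subsetT.
Qed.

Lemma two_le_expR1 (R : realType) : 2 <= expR 1 :> R.
Proof. by have := expR_ge1Dx (1 : R); rewrite -natr1. Qed.

Lemma expR_half_le2 (R : realType) : expR (1 / 2) <= 2 :> R.
Proof.
have := expR_ge1Dx (- (1 / 2) : R); rewrite expRN => ge_half.
have e_gt0 := expR_gt0 (1 / 2 : R).
have := ler_wpM2r (ltW e_gt0) ge_half; rewrite mulVf ?gt_eqF //; lra.
Qed.

Lemma expR_natr_le (R : realType) (n : nat) : 2 ^+ n <= expR (n%:R : R).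
Proof.
by rewrite -[n%:R]mul1r expRM_natr lerXn2r ?nnegrE ?expR_ge0 ?two_le_expR1.
Qed.

Lemma expR_half_natr_le (R : realType) (n : nat) : expR (n%:R / 2 : R) <= 2 ^+ n.
Proof.
rewrite mulrC -[2^-1]mul1r expRM_natr lerXn2r ?nnegrE ?expR_ge0 //.
exact: expR_half_le2.
Qed.

(** From e^l >= l^2 / 2 and e^u >= u^3 / 6 with l = ln ln k, u = ln ln U. Thus the rate exceeds any
    constant for large [k], which later absorbs rounding losses. *)
Lemma rate_ge (R : realType) (k U : nat) :
  (k <= U)%N -> 0 < ln (ln (k%:R : R)) -> ln (ln (k%:R : R)) / 6 <= rate R k U.
Proof.
move=> kU l_gt0; rewrite /rate; set L := ln k%:R in l_gt0 *; set E := ln U%:R.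
have L_gt0 : 0 < L by rewrite ltNge; apply/negP => /ln0 L0; rewrite L0 ltxx in l_gt0.
have k_gt0 : 0 < k%:R :> R.
  by rewrite ltNge; apply/negP => /ln0 k0; rewrite /L k0 ltxx in L_gt0.
have LE : L <= E by rewrite ler_ln ?posrE ?ler_nat // (lt_le_trans k_gt0) ?ler_nat.
have E_gt0 : 0 < E := lt_le_trans L_gt0 LE.
have lu : ln L <= ln E by rewrite ler_ln ?posrE.
have u_gt0 : 0 < ln E := lt_le_trans l_gt0 lu.
have L2 := expR_ge1Dxn 1 (ltW l_gt0); have E3 := expR_ge1Dxn 2 (ltW u_gt0).
rewrite !lnK ?posrE // /= in L2 E3.
rewrite le_min; apply/andP; split.
  rewrite ler_pdivlMr //; move: L2; rewrite (_ : 2`!%:R = 2) //; nra.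
apply: le_trans (_ : ln E / 6 <= _); first by rewrite ler_pM2r // invr_gt0.
rewrite ler_pdivlMr ?exprn_gt0 //; move: E3; rewrite (_ : 3`!%:R = 6) // exprS; lra.
Qed.

(** Split 2^w >= e^(w/2) into two factors e^(w/4): one is at least [L], the other at least 2w once w
    >= 64. *)
Lemma leq_mul_exp2 (R : realType) (L : R) (h w : nat) :
  0 < L -> 4 * ln L <= w%:R -> 64 <= w%:R :> R -> h%:R <= L / 2 ->
  (4 * h * w <= 2 ^ w)%N.
Proof.
move=> L_gt0 Lw w64 hL; rewrite -(ler_nat R) !natrM natrX.
apply: le_trans (expR_half_natr_le R w).
have -> : w%:R / 2 = w%:R / 4 + w%:R / 4 :> R by field.
have Le : L <= expR (w%:R / 4) by rewrite -[leLHS]lnK ?posrE // ler_expR; lra.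
have w4_ge0 : 0 <= w%:R / 4 :> R by lra.
have w2e : 2 * w%:R <= expR (w%:R / 4) :> R.
  by apply: le_trans (expR_ge1Dxn 1 w4_ge0); rewrite (_ : 2`!%:R = 2) //; nra.
rewrite expRD; apply: le_trans (_ : L * (2 * w%:R) <= _); first by nra.
by apply: ler_pM => //; lra.
Qed.

(** Logarithmic form of Q^(3h) k < U, with ln Q <= w. Since E - L >= eps / (1 + eps) E, the constant
    16 leaves room for 3 times 5. *)
Lemma dilate_exponent_lt (R : realType) (eps L E l : R) (h w : nat) :
  0 < eps -> 0 < E -> (1 + eps) * L <= E -> w%:R <= 5 * l ->
  l * h%:R <= eps / (16 * (1 + eps)) * E -> w%:R * (3 * h%:R) + L < E.
Proof.
move=> eps_gt0 E_gt0 LE wl lh; have e1_gt0 : 0 < 1 + eps by lra.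
have wh : w%:R * (3 * h%:R) <= 15 * (eps / (16 * (1 + eps)) * E).
  apply: le_trans (_ : 5 * l * (3 * h%:R) <= _); last by lra.
  by rewrite ler_wpM2r // mulr_ge0.
apply: le_lt_trans (lerD wh (lexx _)) _.
rewrite -(ltr_pM2l e1_gt0) mulrDr.
have -> : (1 + eps) * (15 * (eps / (16 * (1 + eps)) * E)) = 15 / 16 * (eps * E).
  by field; rewrite gt_eqF.
by have := mulr_gt0 eps_gt0 E_gt0; lra.
Qed.

(** The minimum, rounded down, will be [h], which is thus tied to the rate: r l <= L settles one
    branch, r u <= E / u with l <= u the other. *)
Lemma min_ge_rate (R : realType) (c L E l u r : R) :
  0 < c -> 2 * c <= 1 -> 0 < l -> l <= u -> 0 < r ->
  r <= L / l -> r <= E / u ^+ 2 -> c * r * l <= Num.min (L / 2) (c * (E / u)).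
Proof.
move=> c_gt0 c_le l_gt0 lu r_gt0; have u_gt0 := lt_le_trans l_gt0 lu.
rewrite ler_pdivlMr // ler_pdivlMr ?exprn_gt0 // => rL rE.
have rl_gt0 := mulr_gt0 r_gt0 l_gt0.
rewrite le_min -mulrA; apply/andP; split; first by nra.
rewrite ler_pM2l // ler_pdivlMr //; apply: le_trans rE.
by rewrite -mulrA ler_pM2l // expr2 ler_pM2r.
Qed.

(** Here 4^j >= e^j and j + 1 > 2 c sqrt(r); as c sqrt(r) >= 4, half of the exponent pays for the
    rounding and for 8 <= e^3. *)
Lemma expR_le_gain (R : realType) (c r s : R) (j : nat) :
  0 < c -> 0 < r -> 16 / c ^+ 2 <= r -> (2 * c) ^+ 2 * r <= s ->
  Num.sqrt s < j%:R + 1 -> 8 * expR (c * Num.sqrt r) <= (4 ^ j)%N%:R.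
Proof.
move=> c_gt0 r_gt0 r_ge rs j_gt; have c2_gt0 : 0 < 2 * c by rewrite mulr_gt0.
have sr : 4 <= c * Num.sqrt r.
  rewrite mulrC -ler_pdivrMr //.
  have c4_ge0 : 0 <= 4 / c by rewrite divr_ge0 // ltW.
  rewrite -(ger0_norm c4_ge0) -sqrtr_sqr ler_sqrt ?(ltW r_gt0) // expr_div_n.
  by apply: le_trans r_ge; rewrite -natrX.
have jr : 2 * c * Num.sqrt r <= j%:R + 1.
  apply: le_trans (ltW j_gt).
  rewrite -{1}(ger0_norm (ltW c2_gt0)) -sqrtr_sqr -sqrtrM ?sqr_ge0 //.
  by rewrite ler_wsqrtr.
have e3 : 8 <= expR (3%:R) :> R by have := expR_natr_le R 3; rewrite -natrX.
apply: (@le_trans _ _ (expR 3%:R * expR (c * Num.sqrt r))).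
  by rewrite ler_pM2r ?expR_gt0.
rewrite -expRD (_ : 4 = 2 ^ 2)%N // -expnM natrX.
by apply: le_trans (expR_half_natr_le R _); rewrite ler_expR natrM; lra.
Qed.

Lemma exists_parameters (R : realType) (eps : R) : 0 < eps ->
  exists c : R, 0 < c /\ exists K0 : nat, forall k U : nat, (K0 <= k)%N ->
  (k%:R : R) `^ (1 + eps) <= U%:R ->
  (0 < k)%N /\ exists h j w : nat,
   [/\ (0 < h)%N, (0 < w)%N, (4 * h * w <= 2 ^ w)%N & (16 * j ^ 2 * w <= h)%N] /\
   [/\ ('C(h.*2, h) <= k)%N, ((4 * h * w) ^ (3 * h) * k < U)%N &
     8 * expR (c * Num.sqrt (rate R k U)) <= (4 ^ j)%N%:R].
Proof.
move=> eps_gt0; pose c1 : R := eps / (16 * (1 + eps)).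
have e1_gt0 : 0 < 1 + eps by lra.
have c1_gt0 : 0 < c1 by rewrite divr_gt0 ?mulr_gt0.
have c1_le : 2 * c1 <= 1 by rewrite /c1 mulrA ler_pdivrMr ?mulr_gt0 //; lra.
(* The 160 is 2 times 16 times 5, from h >= M / 2, the 16 in the bound on [j], and w <= 5 l. *)
pose c : R := Num.sqrt (c1 / 160) / 2.
have c_gt0 : 0 < c by rewrite divr_gt0 ?ltr0n // sqrtr_gt0 divr_gt0 ?ltr0n.
have cE : (2 * c) ^+ 2 = c1 / 160.
  by rewrite /c mulrC divfK ?pnatr_eq0 // sqr_sqrtr // divr_ge0 ?ler0n ?ltW.
exists c; split=> //.
have cc_gt0 : 0 < 16 / c ^+ 2 by rewrite divr_gt0 // exprn_gt0.
have c2_gt0 : 0 < 2 / c1 by rewrite divr_gt0.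
(* Once ln ln k >= T, the lower bound T / 6 on the rate beats both constants; 28 is ample for w >=
   64 and w <= 5 l. *)
pose T : R := 6 * (16 / c ^+ 2 + 2 / c1) + 28.
have T28 : 28 <= T by rewrite /T; lra.
exists (Num.truncn (expR (expR T))).+1 => k U kK kU.
have kT : expR (expR T) < k%:R.
  by apply: lt_le_trans (truncnS_gt _) _; rewrite ler_nat.
have kr_gt0 : 0 < k%:R :> R := lt_trans (expR_gt0 _) kT.
have k_gt0 : (0 < k)%N by rewrite ltr0n in kr_gt0.
split=> //; set L := ln (k%:R : R); set l := ln L.
have LT : expR T <= L by rewrite -[leLHS]expRK ler_ln ?posrE ?expR_gt0 // ltW.
have L_gt0 : 0 < L := lt_le_trans (expR_gt0 _) LT.
have lT : T <= l by rewrite -[leLHS]expRK ler_ln ?posrE ?expR_gt0.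
have Ur_gt0 : 0 < U%:R :> R by apply: lt_le_trans kU; exact: powR_gt0.
set E := ln (U%:R : R).
have LE1 : (1 + eps) * L <= E by rewrite -ln_powR ler_ln ?posrE // powR_gt0.
have LE : L <= E by apply: le_trans LE1; rewrite ler_peMl ?ltW // ltrDl.
have E_gt0 : 0 < E := lt_le_trans L_gt0 LE.
set u := ln E.
have lu : l <= u by rewrite ler_ln ?posrE.
have l28 : 28 <= l := le_trans T28 lT.
have l_gt0 : 0 < l by apply: lt_le_trans l28.
have u_gt0 : 0 < u := lt_le_trans l_gt0 lu.
have kleU : (k <= U)%N by rewrite -(ler_nat R) -ler_ln ?posrE.
have [rT1 rT2] : 16 / c ^+ 2 <= rate R k U /\ 2 / c1 <= rate R k U.
  have := rate_ge kleU l_gt0; rewrite -/L -/l; move: lT; rewrite /T.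
  by clear -cc_gt0 c2_gt0; lra.
have [rL rE] : rate R k U <= L / l /\ rate R k U <= E / u ^+ 2.
  by rewrite /rate !ge_min !lexx orbT.
move: (rate R k U) rL rE rT1 rT2 => r rL rE rT1 rT2.
have r_gt0 : 0 < r := lt_le_trans c2_gt0 rT2.
pose w := (Num.truncn (4 * l)).+1.
have w_gt : 4 * l < w%:R by exact: truncnS_gt.
have w_le : w%:R <= 5 * l.
  have : (Num.truncn (4 * l))%:R <= 4 * l by rewrite truncn_le mulr_ge0 ?ltW.
  by rewrite /w -natr1; clear -l28; lra.
have w64 : 64 <= w%:R :> R by clear -w_gt l28; lra.
have w_gt0 : 0 < w%:R :> R by rewrite ltr0n.
pose M := Num.min (L / 2) (c1 * (E / u)).
have M_ge : c1 * r * l <= M by exact: min_ge_rate.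
have M2 : 2 <= M.
  apply: le_trans M_ge; have : 2 <= c1 * r by rewrite mulrC -ler_pdivrMr.
  by clear -l28; nra.
have [ML ME] : M <= L / 2 /\ M <= c1 * (E / u) by rewrite /M !ge_min !lexx orbT.
pose h := Num.truncn M.
have h_gt0 : (0 < h)%N by rewrite truncn_gt0 (le_trans _ M2) // ler1n.
have hM : h%:R <= M by rewrite truncn_le (le_trans _ M2).
have Mh : M < h%:R + 1 by rewrite natr1; exact: truncnS_gt.
pose j := Num.truncn (Num.sqrt (h%:R / (16 * w%:R)) : R).
have hw_ge0 : 0 <= h%:R / (16 * w%:R) :> R by rewrite divr_ge0 // mulr_ge0.
have j_le : (j%:R : R) <= Num.sqrt (h%:R / (16 * w%:R)) by rewrite truncn_le sqrtr_ge0.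
have Qw : (4 * h * w <= 2 ^ w)%N.
  by apply: (leq_mul_exp2 L_gt0 (ltW w_gt)) => //; exact: le_trans hM ML.
exists h, j, w; split; split => //.
- rewrite -(ler_nat R) !natrM -expr2.
  have : (j%:R : R) ^+ 2 <= h%:R / (16 * w%:R).
    by rewrite -[leRHS]sqr_sqrtr // lerXn2r ?nnegrE ?sqrtr_ge0.
  by rewrite ler_pdivlMr ?mulr_gt0 // mulrCA mulrA.
(* 4^h <= e^(2h) <= e^L = k. *)
- apply: leq_trans (central_bin_leq h) _.
  rewrite -(ler_nat R) (_ : 4 = 2 ^ 2)%N // -expnM natrX.
  apply: le_trans (expR_natr_le R _) _; rewrite -[leRHS]lnK ?posrE // ler_expR.
  by rewrite natrM mulrC -ler_pdivlMr // (le_trans hM).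
- have QU : ((2 ^ w) ^ (3 * h) * k < U)%N.
    rewrite -(ltr_nat R) natrM -expnM natrX.
    apply: le_lt_trans (_ : expR (w * (3 * h))%:R * k%:R < _).
      by rewrite ler_pM2r // expR_natr_le.
    rewrite -[k%:R]lnK ?posrE // -[ltRHS]lnK ?posrE // -expRD ltr_expR -/L -/E.
    rewrite !natrM; apply: (dilate_exponent_lt eps_gt0 E_gt0 LE1 w_le).
    (* Replacing [l] by the larger [u] cancels the [u] in the bound on [h]. *)
    apply: le_trans (_ : u * (c1 * (E / u)) <= _).
      by apply: ler_pM => //; [exact: ltW | exact: le_trans hM ME].
    by rewrite mulrCA [u * _]mulrC divfK ?gt_eqF.
  by apply: leq_ltn_trans QU; rewrite leq_mul2r leq_exp2r ?Qw ?orbT // muln_gt0.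
apply: (@expR_le_gain _ c r (h%:R / (16 * w%:R))) => //; last first.
  by rewrite natr1; exact: truncnS_gt.
rewrite cE ler_pdivlMr ?mulr_gt0 //.
have : c1 * r * w%:R <= c1 * r * (5 * l) by rewrite ler_pM2l // mulr_gt0.
(* h > M - 1 >= M / 2, because M >= 2. *)
by clear -M_ge M2 Mh; lra.
Qed.

Theorem theorem11p7 (R : realType) (eps : R) (heps : 0 < eps) :
  exists c : R, 0 < c /\
  exists K0 : nat,
  forall (k U p m : nat),
    (K0 <= k)%N ->
    (k%:R : R) `^ (1 + eps) <= U%:R ->
    prime p -> (U < p)%N ->
    (0 < m)%N -> (m <= U)%N ->
    exists (X : {set 'I_U}) (x : 'I_U) (a b : 'I_m),
      #|X| = k /\ x \notin X /\
      cond_prob R p m X x a b >=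
        (1 / (m%:R * k%:R)) * expR (c * Num.sqrt (rate R k U)).
Proof.
have [c [c_gt0 [K0 params]]] := exists_parameters heps.
exists c; split=> //; exists K0 => k U p m kK kU pr_p Up m_gt0 mU.
have [k_gt0 [h [j [w [[h_gt0 w_gt0 Qw jw] [hk QU rate_le]]]]]] := params k U kK kU.
have [X [x [a [b [Xk xX prob_ge]]]]] :=
  exists_correlated_set R pr_p Up m_gt0 mU k_gt0 h_gt0 w_gt0 Qw jw hk QU.
exists X, x, a, b; split=> //; split=> //; apply: le_trans prob_ge.
have mk_gt0 : 0 < m%:R * k%:R :> R by rewrite mulr_gt0 ?ltr0n.
rewrite mul1r [(8 * _)^-1]invfM mulrA [leLHS]mulrC ler_pM2r ?invr_gt0 //.
by rewrite ler_pdivlMr // mulrC.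
Qed.
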